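(* Let $G$ be a graph such that for some $c\in\mathbb{N}$ and for every integer $r\geq 2$, every $r$-ball in $G$ has at most $r^c$ vertices. Then $\rho(G)\leq \sigma(G) \leq c^{O(c)}$; that is, there is an absolute constant $C$ such that $\rho(G)\le\sigma(G)\le c^{Cc}$.
   Context: All graphs are simple and undirected. For a vertex $v$ and $r\in\mathbb{N}$, the $r$-ball $N^r_G[v]$ is the set of vertices at distance at most $r$ from $v$. A walk is a sequence $(v_1,\dots,v_t)$ of vertices with $v_iv_{i+1}$ an edge for each $i$. Given a colouring $\phi$, a sequence $(v_1,\dots,v_{2t})$ is repetitively coloured if $\phi(v_i)=\phi(v_{t+i})$ for all $i\in\{1,\dots,t\}$. A walk $(v_1,\dots,v_{2t})$ is boring if $v_i=v_{t+i}$ for all $i$, and is a stroll if $v_i\neq v_{t+i}$ for all $i\in\{1,\dots,t\}$. A colouring is stroll-nonrepetitive if no stroll is repetitively coloured, and walk-nonrepetitive if every repetitively coloured walk is boring. $\rho(G)$ and $\sigma(G)$ are the minimum numbers of colours in a stroll-nonrepetitive, respectively walk-nonrepetitive, colouring of $G$.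
   Formalization: The bound is proved as σ(G) ≤ max(2,c)^{Cc}, which equals c^{Cc} for every c ≠ 1; for c = 1 the stated bound 1^C = 1 is false, since K_2 satisfies the growth condition with c = 1 but ρ(K_2) = σ(K_2) = 2. *)

(* Defs.v *)
From HB Require Import structures.
From mathcomp Require Import all_boot all_order.
From mathcomp Require Import boolp classical_sets functions cardinality.

Set Implicit Arguments.
Unset Strict Implicit.
Unset Printing Implicit Defensive.

(* The vertex type is arbitrary: infinite graphs are allowed. *)
Record sgraph : Type := SGraph {
  vertex :> Type;
  adj : vertex -> vertex -> Prop;
  adj_sym : forall x y, adj x y -> adj y x;
  adj_irrefl : forall x, ~ adj x x
}.

Definition walk (G : sgraph) (n : nat) (w : 'I_n -> G) : Prop :=
  forall i j : 'I_n, j = i.+1 :> nat -> adj (w i) (w j).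

(* Distance at most r: some walk with at most r edges (hence n.+1 vertices,
   n <= r) joins v to u. *)
Definition dist_le (G : sgraph) (r : nat) (v u : G) : Prop :=
  exists (n : nat) (w : 'I_n.+1 -> G),
    [/\ n <= r, walk w, w ord0 = v & w ord_max = u].

Definition ball (G : sgraph) (r : nat) (v : G) : set G :=
  [set u | dist_le r v u]%classic.

(* A sequence (v_1, ..., v_2t) is a function on 'I_(t + t); its i-th and
   (t + i)-th entries are at lshift t i and rshift t i. *)
Definition repetitively_coloured (G : sgraph) (K : Type) (phi : G -> K)
    (t : nat) (w : 'I_(t + t) -> G) : Prop :=
  forall i : 'I_t, phi (w (lshift t i)) = phi (w (rshift t i)).

Definition boring (G : sgraph) (t : nat) (w : 'I_(t + t) -> G) : Prop :=
  walk w /\ forall i : 'I_t, w (lshift t i) = w (rshift t i).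

Definition stroll (G : sgraph) (t : nat) (w : 'I_(t + t) -> G) : Prop :=
  walk w /\ forall i : 'I_t, w (lshift t i) <> w (rshift t i).

(* t > 0 is essential: the empty sequence would vacuously be a repetitively
   coloured stroll. *)
Definition stroll_nonrepetitive (G : sgraph) (K : Type) (phi : G -> K) : Prop :=
  forall (t : nat) (w : 'I_(t + t) -> G),
    0 < t -> stroll w -> ~ repetitively_coloured phi w.

Definition walk_nonrepetitive (G : sgraph) (K : Type) (phi : G -> K) : Prop :=
  forall (t : nat) (w : 'I_(t + t) -> G),
    0 < t -> walk w -> repetitively_coloured phi w -> boring w.

Definition is_minimum (P : nat -> Prop) (k : nat) : Prop :=
  P k /\ forall j, P j -> k <= j.

(* "rho(G) = k" and "sigma(G) = k".  These are relations because for an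
   infinite graph the minimum over finite numbers of colours need not exist. *)
Definition is_rho (G : sgraph) (k : nat) : Prop :=
  is_minimum
    (fun m => exists phi : G -> 'I_m, stroll_nonrepetitive phi) k.

Definition is_sigma (G : sgraph) (k : nat) : Prop :=
  is_minimum
    (fun m => exists phi : G -> 'I_m, walk_nonrepetitive phi) k.

Definition polynomial_growth (G : sgraph) (c : nat) : Prop :=
  forall r : nat, 2 <= r -> forall v : G, (ball r v #<= `I_(r ^ c))%card.

(* Main.v *)
Require Import Defs.
From HB Require Import structures.
From mathcomp Require Import all_boot all_order.
From mathcomp Require Import zify.
From mathcomp Require Import boolp.

Set Implicit Arguments.
Unset Strict Implicit.
Unset Printing Implicit Defensive.

(* A graph mapping lazily (edges to edges or points) into the tree of words over
   a finite alphabet can be coloured so that repetitively coloured walks have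
   boring images: colour a word by its last letter, its length mod 3 and a
   square-free word read at its length.  It suffices to find O(c) such maps that
   jointly separate all pairs at distance greater than c^O(1), since closer pairs
   are separated by c^O(c) colours greedily.

   Each map comes from a hierarchy of partitions of a finite graph, level i having
   classes of diameter at most D_i with D_(i+1) = D_i^2.  Every class of level i
   gets a code word of length O(c log D_i) that distinguishes it from the other
   classes within distance D_(i+1).  A vertex reads the prefix of this code word
   whose length is its depth in the class, measured in classes of level i - 1;
   concatenating these prefixes from the coarsest level down gives the word of the
   vertex.  Coarse depths change only across finer boundaries, where all finer
   depths vanish, so the map is lazy.  Words with self-delimiting blocks can be
   parsed, hence a vertex deep in its class of level i is separated from every
   vertex at distance between D_i and D_(i+1).  Carving balls of slow growth makes
   every vertex deep in at least one of 8c hierarchies at every level: each new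
   hierarchy shrinks the local density of the uncovered set by the factor
   D_i^(1/4), which after 8c rounds beats the polynomial growth.

   Infinite graphs are reduced to finite ones by compactness. *)

(** * Nonrepetitive colourings of the line and of trees *)

Fixpoint thue_morse_fuel (f n : nat) : bool :=
  if f is f'.+1 then odd n (+) thue_morse_fuel f' n./2 else false.

Definition thue_morse (n : nat) : bool := thue_morse_fuel n n.

Lemma thue_morse_fuelE (f n : nat) : n <= f -> thue_morse_fuel f n = thue_morse n.
Proof.
have z g : thue_morse_fuel g 0 = false by elim: g.
elim/ltn_ind: n f => -[|n] IH [|f] lnf //.
rewrite /thue_morse /= IH ?IH //; lia.
Qed.

Lemma thue_morse_double (n : nat) : thue_morse n.*2 = thue_morse n.
Proof.
case: n => // n; rewrite /thue_morse doubleS /= odd_double /= doubleK.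
rewrite !thue_morse_fuelE //; lia.
Qed.

Lemma thue_morse_doubleS (n : nat) : thue_morse n.*2.+1 = ~~ thue_morse n.
Proof.
rewrite /thue_morse /= odd_double /= uphalf_double thue_morse_fuelE //; lia.
Qed.

Lemma thue_morse_eq_succ (n : nat) : thue_morse n = thue_morse n.+1 -> odd n.
Proof.
have [m ->] : exists m, n = odd n + m.*2 by exists n./2; rewrite odd_double_half.
case: (odd n) => //=; last by rewrite add0n thue_morse_double thue_morse_doubleS; case: thue_morse.
by rewrite oddD odd_double.
Qed.

(** With [m] half of [n], unequal letters at [m] and [m.+1] give equal ones at [m.*2.+1] and
    [m.*2.+2]. Equal letters force [m] to be odd, so those at [m.+1] and [m.+2] differ and the same
    argument applies there. *)
Lemma thue_morse_repeat_near (n : nat) :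
  exists2 i, n <= i < n + 4 & thue_morse i = thue_morse i.+1.
Proof.
pose m := n./2.
have e j : thue_morse j = ~~ thue_morse j.+1 -> thue_morse j.*2.+1 = thue_morse j.+1.*2.
  by rewrite thue_morse_doubleS thue_morse_double => ->; rewrite negbK.
case E1 : (thue_morse m == ~~ thue_morse m.+1).
  by exists m.*2.+1; [rewrite /m; lia | rewrite (e _ (eqP E1)) doubleS].
have E1' : thue_morse m = thue_morse m.+1 by move: E1; do 2 case: thue_morse.
exists m.+1.*2.+1; first by rewrite /m; lia.
rewrite -[in RHS]doubleS; apply: e.
case E2 : (thue_morse m.+1 == ~~ thue_morse m.+2); first exact: (eqP E2).
have E2' : thue_morse m.+1 = thue_morse m.+2 by move: E2; do 2 case: thue_morse.
by have := thue_morse_eq_succ E1'; have /= := thue_morse_eq_succ E2' => /negbTE ->.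
Qed.

(** An even period is halved by reading every second letter. For an odd period, adjacent equal
    letters start at odd positions only, yet a shift by the period moves such a pair to an even
    position. *)
Lemma thue_morse_overlap_free (p n : nat) : 0 < p ->
  ~ (forall i, i <= p -> thue_morse (n + i) = thue_morse (n + i + p)).
Proof.
elim/ltn_ind: p n => p IH n p0 ov.
case op : (odd p); last first.
  have pE : p = p./2.*2 by lia.
  pose b := odd n; pose m := n./2.
  have nE : n = b + m.*2 by rewrite odd_double_half.
  apply: (IH p./2 _ m); [lia | lia | move=> i ip].
  have := ov i.*2 ltac:(lia).
  rewrite (_ : n + i.*2 = b + (m + i).*2); last lia.
  rewrite (_ : b + _ + p = b + (m + i + p./2).*2); last lia.
  case: b {nE} => /=; rewrite ?add1n ?add0n ?thue_morse_double ?thue_morse_doubleS //.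
  exact: negb_inj.
have [p1|p3] : p = 1 \/ 3 <= p by lia.
  have := ov 0 ltac:(lia); have := ov 1 ltac:(lia); rewrite p1 !addn0 !addn1.
  by move=> /thue_morse_eq_succ /= /negP h /thue_morse_eq_succ.
have [i ilt ei] := thue_morse_repeat_near n.
have oi := thue_morse_eq_succ ei.
have [ip|ip] := leqP i.+1 (n + p).
  have := ov (i - n) ltac:(lia); have := ov (i.+1 - n) ltac:(lia).
  rewrite !subnKC; [|lia..].
  by rewrite -ei addSn => -> /esym /thue_morse_eq_succ; rewrite oddD oi op.
have := ov (i - p - n) ltac:(lia); have := ov (i.+1 - p - n) ltac:(lia).
rewrite !(subnKC, subnK); [|lia..].
rewrite -ei (_ : i.+1 - p = (i - p).+1); last lia.
by move=> <- /thue_morse_eq_succ; rewrite oddB ?oi ?op //; lia.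
Qed.

Definition square_free_word (n : nat) : bool * bool :=
  (thue_morse n, thue_morse n.+1).

(* Equality of pairs of consecutive letters over a period gives an overlap,
   since the last pair contributes one more letter. *)
Lemma square_free_wordP (p n : nat) : 0 < p ->
  ~ (forall i, i < p -> square_free_word (n + i) = square_free_word (n + i + p)).
Proof.
move=> p0 sq; apply: (@thue_morse_overlap_free p n p0) => i.
rewrite leq_eqVlt => /orP[/eqP ->|/sq[] //].
have /sq [_] : p.-1 < p by lia.
by rewrite (_ : (n + p.-1).+1 = n + p) 1?(_ : (n + p.-1 + p).+1 = n + p + p) //; lia.
Qed.

Definition line_colour (n : nat) : 'I_3 * (bool * bool) :=
  (inord (n %% 3), square_free_word n).

Lemma line_colour_mod (m n : nat) : line_colour m = line_colour n -> m = n %[mod 3].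
Proof. by case=> /(congr1 (@nat_of_ord _)); rewrite !inordK ?ltn_mod // => ->. Qed.

Lemma lazy_walk_ivt (x : nat -> nat) (s k : nat) :
  (forall i, i < s -> x i.+1 <= (x i).+1) -> x 0 <= k <= x s ->
  exists2 i, i <= s & x i = k.
Proof.
elim: s => [|s IH] step /andP[h0 h1]; first by exists 0 => //; lia.
have [h|h] := leqP k (x s).
  have [||i il e] := IH; [by move=> i is_; apply: step; lia | lia |].
  by exists i => //; lia.
by exists s.+1 => //; have := step s ltac:(lia); lia.
Qed.

(** Steps are -1, 0 or 1, so residues mod 3 force equal steps in both halves, and the second half is
    a translate of the first. A nonzero translation would yield a square in the square-free word, as
    the first half visits every height between [x 0] and [x t]. *)
Lemma line_nonrepetitive (t : nat) (x : nat -> nat) :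
  (forall i, i.+1 < t + t -> x i <= (x i.+1).+1 /\ x i.+1 <= (x i).+1) ->
  (forall i, i < t -> line_colour (x i) = line_colour (x (t + i))) ->
  forall i, i < t -> x i = x (t + i).
Proof.
move=> step rep.
have md i : i < t -> x i = x (t + i) %[mod 3] by move=> /rep /line_colour_mod.
have shift i : i < t -> x i + x t = x (t + i) + x 0.
  elim: i => [|i IH] it; first by rewrite addn0 addnC.
  have := IH (ltnW it); have := md _ it; have := md _ (ltnW it).
  have := step i ltac:(lia); have := step (t + i) ltac:(lia); rewrite addnS; lia.
case: t step rep md shift => [//|t] step rep md shift.
have [e|/eqP ne] := eqVneq (x t.+1) (x 0).
  by move=> i /shift; lia.
exfalso.
have [lt|gt] := ltnP (x 0) (x t.+1).
  pose p := x t.+1 - x 0.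
  apply: (@square_free_wordP p (x 0)); first by rewrite /p; lia.
  move=> k kp.
  have [||i it xi] := @lazy_walk_ivt x t (x 0 + k).
  - by move=> i it; have := step i ltac:(lia); lia.
  - by have := step t ltac:(lia); rewrite /p in kp *; lia.
  have := rep i ltac:(lia); have := shift i ltac:(lia).
  by rewrite xi => h /(congr1 snd) /= ->; congr (square_free_word _); rewrite /p; lia.
(* A descending walk is read backwards in time, since [lazy_walk_ivt] only climbs. *)
pose p := x 0 - x t.+1.
have rx k : x t.+1 < k <= x 0 -> p <= k /\ square_free_word (k - p) = square_free_word k.
  move=> kp.
  have [||i it] := @lazy_walk_ivt (fun i => x (t - i)) t k.
  - move=> i it; have := step (t - i.+1) ltac:(lia).
    by rewrite (_ : (t - i.+1).+1 = t - i); lia.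
  - by have := step t ltac:(lia); rewrite subn0 subnn; lia.
  move=> xi; have := rep (t - i) ltac:(lia); have := shift (t - i) ltac:(lia).
  by rewrite xi => h /(congr1 snd) /= ->; split; [|congr (square_free_word _)]; rewrite /p; lia.
have [pk _] := rx (x t.+1).+1 ltac:(lia).
apply: (@square_free_wordP p ((x t.+1).+1 - p)); first by rewrite /p; lia.
move=> k kp; have [pk' <-] := rx ((x t.+1).+1 - p + k + p) ltac:(rewrite /p in kp *; lia).
by rewrite addnK.
Qed.

Definition tree_adj (T : Type) (s t : seq T) : Prop :=
  s = t \/ exists a, t = rcons s a \/ s = rcons t a.

Lemma tree_adj_sym (T : Type) (s t : seq T) : tree_adj s t -> tree_adj t s.
Proof. by case=> [->|[a [->|->]]]; [left|right; exists a; right|right; exists a; left]. Qed.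

Lemma tree_adj_cat (T : Type) (p s t : seq T) : tree_adj s t -> tree_adj (p ++ s) (p ++ t).
Proof.
case=> [->|[a [->|->]]]; first by left.
  by right; exists a; left; rewrite rcons_cat.
by right; exists a; right; rewrite rcons_cat.
Qed.

Lemma tree_adj_take (T : Type) (s : seq T) (m n : nat) :
  m <= n.+1 -> n <= m.+1 -> tree_adj (take m s) (take n s).
Proof.
have H k : tree_adj (take k s) (take k.+1 s).
  elim: s k => [|a s IH] k; first by left.
  by case: k => [|k] /=; [right; exists a; left; rewrite take0 | exact: (tree_adj_cat [:: a])].
move=> mn nm; have [->|[->|->]] : m = n \/ n = m.+1 \/ m = n.+1 by lia.
- by left.
- exact: H.
- exact/tree_adj_sym/H.
Qed.

Lemma tree_adj_size (T : Type) (s t : seq T) : tree_adj s t ->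
  size s <= (size t).+1 /\ size t <= (size s).+1.
Proof. by case=> [->|[a [->|->]]]; rewrite ?size_rcons; lia. Qed.

Definition last_letter (T : Type) (s : seq T) : option T := last None (map Some s).

Definition tree_colour (T : Type) (s : seq T) : option T * ('I_3 * (bool * bool)) :=
  (last_letter s, line_colour (size s)).

Lemma last_letter_rcons (T : Type) (s : seq T) a : last_letter (rcons s a) = Some a.
Proof. by rewrite /last_letter map_rcons last_rcons. Qed.

(** A word has at most one parent, and its children differ in their last letters. *)
Lemma tree_adj_inj (T : Type) (s t t' : seq T) : tree_adj s t -> tree_adj s t' ->
  size t = size t' -> last_letter t = last_letter t' -> t = t'.
Proof.
case=> [->|[a [->|->]]] [<-|[b [e|e]]] //; rewrite ?size_rcons.
- by move: e => ->; rewrite size_rcons; lia.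
- by rewrite e size_rcons; lia.
- by lia.
- by rewrite e !last_letter_rcons => _ [->].
- by move: (congr1 size e); rewrite e !size_rcons; lia.
- by lia.
- by rewrite e !size_rcons; lia.
- by have [] := rcons_inj e.
Qed.

(** By the line case the halves have equal lengths throughout. The prefix of minimal length [m]
    never changes, so they meet at the time [i0] of minimal length; from there [tree_adj_inj]
    carries equality forwards and backwards. *)
Lemma tree_nonrepetitive (T : eqType) (t : nat) (x : nat -> seq T) :
  (forall i, i.+1 < t + t -> tree_adj (x i) (x i.+1)) ->
  (forall i, i < t -> tree_colour (x i) = tree_colour (x (t + i))) ->
  forall i, i < t -> x i = x (t + i).
Proof.
move=> step rep.
have sz i : i < t -> size (x i) = size (x (t + i)).
  apply: (@line_nonrepetitive t (fun i => size (x i))) => j jt.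
    exact/tree_adj_size/step.
  by have := rep j jt; rewrite /tree_colour => /(congr1 snd).
have lst i : i < t -> last_letter (x i) = last_letter (x (t + i)).
  by move=> /rep /(congr1 fst).
case: t step rep sz lst => [//|t] step rep sz lst.
pose i0 := [arg min_(i < (ord0 : 'I_t.+1)) size (x i)].
pose m := size (x i0).
have mle i : i < t.+1 + t.+1 -> m <= size (x i).
  have H j : j < t.+1 -> m <= size (x j).
    by move=> jt; rewrite /m /i0; case: arg_minnP => // k _ /(_ (Ordinal jt) isT).
  by move=> it; have [/H //|ti] := ltnP i t.+1; rewrite -(subnKC ti) -sz; [apply: H|]; lia.
have tk i : i < t.+1 + t.+1 -> take m (x i) = take m (x 0).
  elim: i => // i IH it; rewrite -IH; last lia.
  have := mle _ it; have := mle i ltac:(lia).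
  case: (step i it) => [->|[a [->|->]]] // h1 h2; rewrite -cats1 take_cat.
    by case: ltnP => // h; rewrite (_ : m - _ = 0) ?take0 ?cats0 ?take_oversize //; lia.
  by case: ltnP => // h; rewrite (_ : m - _ = 0) ?take0 ?cats0 ?take_oversize //; lia.
have e0 : x i0 = x (t.+1 + i0).
  have it := ltn_ord i0.
  have := tk i0 ltac:(lia); rewrite -(tk (t.+1 + i0) ltac:(lia)).
  by rewrite !take_oversize //; rewrite -sz.
have up i : x i = x (t.+1 + i) -> i.+1 < t.+1 -> x i.+1 = x (t.+1 + i.+1).
  move=> e it; apply: (@tree_adj_inj _ (x i)); [| |exact: sz|exact: lst]; first by apply: step; lia.
  by rewrite e addnS; apply: step; lia.
have down i : x i.+1 = x (t.+1 + i.+1) -> i.+1 < t.+1 -> x i = x (t.+1 + i).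
  move=> e it; apply: (@tree_adj_inj _ (x i.+1)); [| |by apply: sz; lia|by apply: lst; lia].
    by apply/tree_adj_sym/step; lia.
  by rewrite e addnS; apply/tree_adj_sym/step; lia.
have above k : i0 + k < t.+1 -> x (i0 + k) = x (t.+1 + (i0 + k)).
  elim: k => [|k IH] h; first by rewrite addn0.
  by rewrite addnS; apply: up; [apply: IH|]; lia.
have below k : k <= i0 -> x (i0 - k) = x (t.+1 + (i0 - k)).
  elim: k => [|k IH] h; first by rewrite subn0.
  have it := ltn_ord i0.
  apply: down; rewrite -subSn //; last lia.
  by rewrite subSS; apply: IH; lia.
move=> i it; have [h|h] := leqP i0 i; first by rewrite -(subnKC h); apply: above; rewrite subnKC.
by rewrite -(subKn (ltnW h)); apply: below; rewrite leq_subr.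
Qed.

(** * Distance and ball carving in finite graphs *)

Section FiniteDistance.
Variables (V : finType) (e : rel V).

Fixpoint dist_leb (r : nat) (u v : V) : bool :=
  if r is r'.+1 then [exists w, dist_leb r' u w && ((w == v) || e w v)] else u == v.

Lemma dist_leb0 u v : dist_leb 0 u v = (u == v).
Proof. by []. Qed.

Lemma dist_lebS r u v :
  dist_leb r.+1 u v = [exists w, dist_leb r u w && ((w == v) || e w v)].
Proof. by []. Qed.

Lemma dist_leb_refl r u : dist_leb r u u.
Proof. by elim: r => //= r IH; apply/existsP; exists u; rewrite IH eqxx. Qed.

Lemma dist_leb_step r u w v : dist_leb r u w -> e w v -> dist_leb r.+1 u v.
Proof. by move=> h1 h2 /=; apply/existsP; exists w; rewrite h1 h2 orbT. Qed.

Lemma dist_leb_trans r s u v w : dist_leb r u v -> dist_leb s v w -> dist_leb (r + s) u w.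
Proof.
move=> uv; elim: s w => [|s IH] w /=; first by move=> /eqP <-; rewrite addn0.
move=> /existsP[z /andP[/IH h1 h2]]; rewrite addnS /=.
by apply/existsP; exists z; rewrite h1.
Qed.

Lemma dist_leb_leq r s u v : r <= s -> dist_leb r u v -> dist_leb s u v.
Proof.
by move=> rs h; rewrite -(subnKC rs); apply: dist_leb_trans h (dist_leb_refl _ _).
Qed.

Hypothesis e_sym : symmetric e.

Lemma dist_leb_sym r u v : dist_leb r u v = dist_leb r v u.
Proof.
suff H a b : dist_leb r a b -> dist_leb r b a by apply/idP/idP; apply: H.
elim: r a b => [|r IH] a b /=; first by rewrite eq_sym.
move=> /existsP[w /andP[/IH h /orP[/eqP wb|ewb]]].
  by apply/existsP; exists a; rewrite -wb h eqxx.
rewrite -[X in is_true X]/(dist_leb (1 + r) b a); apply: dist_leb_trans h.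
rewrite e_sym in ewb.
by apply: dist_leb_step ewb; apply: dist_leb_refl.
Qed.

End FiniteDistance.

Arguments dist_leb : simpl never.

(** Otherwise each step multiplies [s] by more than [E.+1 / E], too much after [m] steps. *)
Lemma slow_growth_step (s : nat -> nat) (E m : nat) :
  0 < s 0 -> s m * E ^ m < E.+1 ^ m ->
  exists2 j, j < m & E * s j.+1 <= E.+1 * s j.
Proof.
move=> s0 sm.
case: (boolP [exists j : 'I_m, E * s j.+1 <= E.+1 * s j]) => [/existsP[j h]|].
  by exists j.
rewrite negb_exists => /forallP fast; exfalso.
have H j : j <= m -> E.+1 ^ j <= s j * E ^ j.
  elim: j => [|j IH] jm; first by rewrite !expn0 muln1.
  have := fast (Ordinal jm); rewrite -ltnNge /= => fj.
  have := IH (ltnW jm) => h.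
  rewrite !expnS mulnCA mulnA; apply: leq_trans (_ : E.+1 * (s j * E ^ j) <= _).
    by rewrite leq_mul2l h orbT.
  by rewrite mulnA leq_mul2r (ltnW fj) orbT.
by have := H m (leqnn m); lia.
Qed.

(* [al] sends a vertex to the centre of the ball that removed it from [A], and
   [core] selects the inner balls, which are [L]-separated from each other. *)
Lemma carve_in (W : finType) (e : rel W) (mu : W -> nat) (L m E : nat) :
  symmetric e ->
  (forall a, 0 < mu a ->
     (\sum_(b | dist_leb e (L * m) a b) mu b) * E ^ m < E.+1 ^ m) ->
  forall A : {set W}, exists (al : W -> W) (core : pred W),
  [/\ forall b, b \in A -> dist_leb e (L * m) (al b) b /\ al b \in A,
      forall b b', b \in A -> b' \in A -> core b -> core b' ->
        dist_leb e L b b' -> al b = al b' &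
      forall a, E * \sum_(b in A | (al b == a) && ~~ core b) mu b
        <= \sum_(b in A | (al b == a) && core b) mu b].
Proof.
move=> e_sym small A; have [n An] := ubnP #|A|; elim: n A An => // n IH A An.
case: (pickP [pred v in A | 0 < mu v]) => [v /andP[/= vA v0]|none]; last first.
  exists id, pred0; split=> //.
    by move=> b bA; split=> //; apply: dist_leb_refl.
  move=> a; rewrite big1 ?muln0 // => b /andP[bA _].
  by have := none b; rewrite /= bA /=; case: (mu b).
pose B j := [set b in A | dist_leb e (L * j) v b].
(* The radius is chosen where growth is slow: [B j] becomes core, the rest of [B j.+1] is the light
   boundary, and both leave [A]. *)
have [|| j jm slow] := @slow_growth_step (fun j => \sum_(b in B j) mu b) E m.
- rewrite (bigD1 v) /=; first by rewrite addn_gt0 v0.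
  by rewrite inE vA dist_leb_refl.
- apply: leq_ltn_trans (small _ v0); rewrite leq_mul2r; apply/orP; right.
  rewrite [leqRHS](bigID (mem A)) /= -[leqLHS]addn0 leq_add //.
  by apply: eq_leq; apply: eq_bigl => b; rewrite inE andbC.
pose A' := A :\: B j.+1.
have vB k : v \in B k by rewrite inE vA dist_leb_refl.
have BS : B j \subset B j.+1.
  apply/subsetP => b; rewrite !inE => /andP[-> h] /=.
  by apply: dist_leb_leq h; rewrite leq_mul2l leqnSn orbT.
have [|al [core [c1 c2 c3]]] := IH A'.
  apply: leq_trans (_ : #|A| <= n); last by [].
  apply: proper_card; apply/properP; split; first exact: subsetDl.
  by exists v => //; rewrite !inE vA dist_leb_refl.
exists (fun b => if b \in A' then al b else v),
  (fun b => if b \in A' then core b else b \in B j); split.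
- move=> b bA; case: ifP => bA'.
    by have [h1] := c1 _ bA'; rewrite inE => /andP[_ h2].
  split=> //; move: bA'; rewrite !inE bA /= andbT => /negbFE.
  by apply: dist_leb_leq; rewrite leq_mul2l jm orbT.
(* Vertices of [A] within [L] of [B j] lie in [B j.+1], so later cores keep their distance. *)
- have aux b b' : b \in A -> b' \in A' -> b \in B j -> dist_leb e L b b' -> False.
    move=> bA; rewrite !inE => /andP[h b'A]; rewrite b'A /= in h.
    move=> /andP[_ h1] h2; case/negP: h; rewrite mulnS addnC.
    exact: dist_leb_trans h1 h2.
  move=> b b' bA b'A; case: ifP => bA'; case: ifP => b'A' // h1 h2 w.
  + exact: c2 w.
  + by case: (aux b' b) => //; rewrite dist_leb_sym.
  + by case: (aux b b').
- move=> a; have [->|av] := eqVneq a v; last first.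
    have H (P Q : pred W) : (forall b, b \in A' -> P b = Q b) ->
      \sum_(b in A | ((if b \in A' then al b else v) == a) && P b) mu b =
      \sum_(b in A' | (al b == a) && Q b) mu b.
      move=> PQ; apply: eq_bigl => b; case: ifP => bA'.
        by rewrite PQ //; move: bA'; rewrite inE => /andP[_ ->].
      by rewrite eq_sym (negbTE av) /= andbF.
    rewrite (H _ (predC core)); last by move=> b ->.
    by rewrite (H _ core) //; last by move=> b ->.
  have H (P : pred W) :
      \sum_(b in A | ((if b \in A' then al b else v) == v) && P b) mu b =
      \sum_(b in B j.+1 | P b) mu b.
    apply: eq_bigl => b; case: ifP => bA'; last first.
      rewrite eqxx /=; move: bA'; rewrite !inE; case: (b \in A) => //=.
      by rewrite andbT => /negbFE ->.
    have [_ aA] := c1 _ bA'; have /negbTE -> : al b != v.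
      by apply: contraTneq aA => ->; rewrite in_setD vB.
    by move: bA'; rewrite in_setD => /andP[/negbTE -> _]; rewrite andbF.
  rewrite !H.
  have -> : \sum_(b in B j.+1 | if b \in A' then core b else b \in B j) mu b = \sum_(b in B j) mu b.
    apply: eq_bigl => b; rewrite in_setD; case bB : (b \in B j.+1) => //=.
    by apply/esym; apply: contraFF bB; apply: subsetP.
  move: slow; rewrite (bigID (mem (B j))) /= mulnDr mulSn addnC.
  have -> : \sum_(i in B j.+1 | i \in B j) mu i = \sum_(b in B j) mu b.
    by apply: eq_bigl => b; rewrite andb_idl //; apply: subsetP.
  have -> : \sum_(i in B j.+1 | i \notin B j) mu i =
     \sum_(b in B j.+1 | ~~ (if b \in A' then core b else b \in B j)) mu b.
    by apply: eq_bigl => b; rewrite in_setD; case: (b \in B j.+1).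
  by rewrite leq_add2r.
Qed.

Lemma carve (W : finType) (e : rel W) (mu : W -> nat) (L m E : nat) :
  symmetric e ->
  (forall a, 0 < mu a ->
     (\sum_(b | dist_leb e (L * m) a b) mu b) * E ^ m < E.+1 ^ m) ->
  exists (al : W -> W) (core : pred W),
  [/\ forall b, dist_leb e (L * m) (al b) b,
      forall b b', core b -> core b' -> dist_leb e L b b' -> al b = al b' &
      forall a, E * \sum_(b | (al b == a) && ~~ core b) mu b
        <= \sum_(b | (al b == a) && core b) mu b].
Proof.
move=> e_sym small; have [al [core [c1 c2 c3]]] := carve_in e_sym small setT.
exists al, core; split.
- by move=> b; have [] := c1 b (in_setT b).
- by move=> b b'; apply: c2; rewrite in_setT.
- by move=> a; have := c3 a; congr (_ * _ <= _); apply: eq_bigl => b; rewrite in_setT.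
Qed.

Lemma greedy_colouring (W K : finType) (r : rel W) : symmetric r ->
  (forall a, #|[set b | r a b & b != a]| < #|K|) ->
  exists col : W -> K, forall a b, r a b -> a != b -> col a <> col b.
Proof.
move=> r_sym deg.
have [k0|W0] : {_ : K | True} + (W -> False).
  case: (pickP (@predT K)) => [k _|noK]; first by left; exists k.
  by right=> a; have := deg a; rewrite (eq_card0 noK).
2: by exists (fun a => match W0 a with end) => a; case: (W0 a).
suff H (A : {set W}) : exists col : W -> K,
    forall a b, a \in A -> b \in A -> r a b -> a != b -> col a <> col b.
  by have [col H'] := H setT; exists col => a b; apply: H'; rewrite in_setT.
have [n An] := ubnP #|A|; elim: n A An => // n IH A An.
case: (set_0Vmem A) => [->|[v vA]].
  by exists (fun=> sval k0) => a b; rewrite inE.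
have [|col c1] := IH (A :\ v); first by move: An; rewrite (cardsD1 v A) vA; lia.
have /subsetPn[k _ kN] : ~~ ([set: K] \subset [set col b | b in [set b | r v b & b != v]]).
  apply/negP => /subset_leq_card; rewrite cardsT => h.
  by have := leq_trans h (leq_imset_card _ _); rewrite leqNgt deg.
exists (fun b => if b == v then k else col b).
have nk b : r v b -> b != v -> k <> col b.
  by move=> rb bv kE; case/imsetP: kN; exists b; rewrite ?inE ?rb.
move=> a b aA bA rab ab; case: ifP => [/eqP av|av]; case: ifP => [/eqP bv|bv].
- by move: ab; rewrite av bv eqxx.
- by apply: nk; [rewrite -av | rewrite bv].
- by move=> /esym; apply: nk; [rewrite r_sym -bv | rewrite av].
- by apply: c1; rewrite // !inE ?av ?bv.
Qed.

(** * Padded coarsenings *)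

Definition fball (V : finType) (e : rel V) (r : nat) (v : V) : {set V} :=
  [set u | dist_leb e r v u].

Lemma sum_fibres_card (V W : finType) (X : {set V}) (f : V -> W) (P : pred W) :
  \sum_(b | P b) #|[set v in X | f v == b]| = #|[set v in X | P (f v)]|.
Proof.
rewrite -[RHS]sum1_card (partition_big f P); last by move=> v; rewrite inE => /andP[].
apply: eq_bigr => b Pb; rewrite -sum1_card; apply: eq_bigl => v; rewrite !inE.
by case: eqVneq => [->|]; rewrite ?andbF ?Pb ?andbT.
Qed.

(** A partition is a map [p : V -> V] with the classes as fibres, so the quotient graph lives on [V]
    again; points outside the image of [p] are isolated. *)
Definition quotient_rel (V : finType) (e : rel V) (p : V -> V) : rel V :=
  fun a b => [exists u, exists v, [&& p u == a, p v == b & e u v]].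

Lemma quotient_rel_sym (V : finType) (e : rel V) (p : V -> V) :
  symmetric e -> symmetric (quotient_rel e p).
Proof.
move=> e_sym; suff H a b : quotient_rel e p a b -> quotient_rel e p b a.
  by move=> a b; apply/idP/idP; apply: H.
move=> /existsP[u /existsP[v /and3P[pu pv uv]]].
by apply/existsP; exists v; apply/existsP; exists u; rewrite pu pv e_sym uv.
Qed.

Lemma quotient_relI (V : finType) (e : rel V) (p : V -> V) u v :
  e u v -> quotient_rel e p (p u) (p v).
Proof. by move=> uv; apply/existsP; exists u; apply/existsP; exists v; rewrite !eqxx. Qed.

Lemma dist_leb_quotient (V : finType) (e : rel V) (p : V -> V) (D r : nat) u v :
  (forall u v, p u = p v -> dist_leb e D u v) ->
  dist_leb (quotient_rel e p) r (p u) (p v) -> dist_leb e (r * D.+1 + D) u v.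
Proof.
move=> diam; elim: r v => [|r IH] v; first by rewrite dist_leb0 mul0n => /eqP /diam.
rewrite dist_lebS => /existsP[b /andP[ub /orP[/eqP bv|]]].
  rewrite bv in ub; apply: dist_leb_leq (IH _ ub); lia.
move=> /existsP[u' /existsP[v' /and3P[/eqP pu' /eqP pv' uv']]].
rewrite -pu' in ub; have := dist_leb_step (IH _ ub) uv'.
move=> /dist_leb_trans /(_ (diam _ _ pv')); apply: dist_leb_leq; lia.
Qed.

(* One coordinate of one level: [p'] coarsens [p]; [g] is the depth inside the
   clusters of [p'], counted in clusters of [p] and truncated at [L]; [I] is the
   set of vertices of full depth. *)
Lemma padded_coarsening (V : finType) (e : rel V) (p : V -> V) (X : {set V})
    (D D' L m E c : nat) :
  symmetric e -> 1 < D ->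
  (forall v, #|fball e D v| <= D ^ c) ->
  (forall u v, p u = p v -> dist_leb e D' u v) ->
  2 * (2 * L * m + L) * D'.+1 + D' <= D ->
  D ^ c * E ^ m < E.+1 ^ m ->
  exists (p' : V -> V) (g : V -> nat) (I : {set V}),
  [/\ [/\ forall u v, p u = p v -> p' u = p' v,
       forall u v, p u = p v -> g u = g v &
       forall u v, p' u = p' v -> dist_leb e D u v],
     forall u v, e u v -> g u <= (g v).+1,
     forall u v, e u v -> p' u <> p' v -> g u = 0,
     forall v, v \in I -> g v = L &
     forall u s, E * #|(X :\: I) :&: fball e s u| <= #|X :&: fball e (s + D) u|].
Proof.
move=> e_sym D1 growth diam DD' Em.
pose q := quotient_rel e p.
have q_sym : symmetric q by apply: quotient_rel_sym.
(* A class weighs as many vertices of [X] as it contains. Separation [2 * L] keeps the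
   [L]-neighbourhoods of cores with different centres disjoint. *)
pose mu b := #|[set v in X | p v == b]|.
have [|al [core [c1 c2 c3]]] := @carve V q mu (2 * L) m E q_sym.
  move=> a; rewrite card_gt0 => /set0Pn[u]; rewrite inE => /andP[_ /eqP pu].
  apply: leq_ltn_trans Em; rewrite leq_mul2r sum_fibres_card; apply/orP; right.
  apply: leq_trans (growth u); apply: subset_leq_card; apply/subsetP => v.
  rewrite !inE -pu => /andP[_ /(dist_leb_quotient diam)]; apply: dist_leb_leq; nia.
(* [near] is monotone in [j], so [g] is [L] minus the quotient distance to the nearest core, cut off
   at 0. *)
pose near j v := [exists b, core b && dist_leb q j b (p v)].
pose p' v := if [pick b | core b && dist_leb q L b (p v)] is Some b then al b else p v.
pose g v := \sum_(j < L) near j v.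
have p'E b v : core b -> dist_leb q L b (p v) -> p' v = al b.
  move=> cb bv; rewrite /p'; case: pickP => [b' /andP[cb' b'v]|/(_ b)]; last by rewrite cb bv.
  apply: c2 => //; rewrite mul2n -addnn.
  by apply: dist_leb_trans b'v _; rewrite dist_leb_sym.
have near_step j u v : e u v -> near j u -> near j.+1 v.
  move=> uv /existsP[b /andP[cb bu]]; apply/existsP; exists b; rewrite cb.
  exact: dist_leb_step bu (quotient_relI _ uv).
have p'_near v : dist_leb q (2 * L * m + L) (p' v) (p v).
  rewrite /p'; case: pickP => [b /andP[cb bv]|_]; last exact: dist_leb_refl.
  exact: dist_leb_trans (c1 b) bv.
exists p', g, [set v | core (p v)]; split; first split.
- by move=> u v uv; rewrite /p' uv.
- by move=> u v uv; rewrite /g /near uv.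
- move=> u v uv.
  have h : dist_leb q ((2 * L * m + L) + (2 * L * m + L)) (p u) (p v).
    by apply: (@dist_leb_trans _ _ _ _ _ (p' u)); [rewrite dist_leb_sym | rewrite uv].
  apply: dist_leb_leq (dist_leb_quotient diam h); lia.
- move=> u v uv; rewrite /g.
  apply: leq_trans (_ : \sum_(j < L) near j.+1 v <= _).
    by apply: leq_sum => j _; have := near_step j u v uv; case: (near j u) => // ->.
  apply: leq_trans (_ : \sum_(j < L.+1) near j v <= _).
    by rewrite big_ord_recl; apply: leq_trans (leq_addl _ _).
  by rewrite big_ord_recr /=; case: (near L v); rewrite ?addn1 ?addn0.
- move=> u v uv p'uv; rewrite /g big1 // => j _; apply/eqP; rewrite eqb0; apply/negP.
  move=> nj; apply: p'uv.
  have /existsP[b /andP[cb bu]] := nj.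
  rewrite (p'E b u) ?(p'E b v) //; last exact: dist_leb_leq (ltnW (ltn_ord j)) bu.
  apply: dist_leb_leq (ltn_ord j) _; exact: dist_leb_step bu (quotient_relI _ uv).
- move=> v; rewrite inE => cv; rewrite /g (eq_bigr (fun=> 1)) ?sum1_card ?card_ord // => j _.
  by rewrite /near; case: existsP => // -[]; exists (p v); rewrite cv dist_leb_refl.
move=> u s.
have c3' a : E * #|[set v in X | (al (p v) == a) && ~~ core (p v)]|
    <= #|[set v in X | (al (p v) == a) && core (p v)]|.
  by have := c3 a; rewrite !(sum_fibres_card X p).
set I := [set v | core (p v)]; set Y := (X :\: I) :&: fball e s u.
(* [T] lists the centres of the carved balls meeting [Y]; such a ball has diameter at most [D] in
   [e], so its core is counted within radius [s + D]. *)
pose T := [set al (p v) | v in Y].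
pose f v := al (p v).
have -> : #|Y| = \sum_(a in T) #|[set v in Y | f v == a]|.
  rewrite (sum_fibres_card Y f (mem T)); apply: eq_card => v; rewrite [RHS]inE.
  by case vY: (v \in Y) => //=; apply/esym/imsetP; exists v.
rewrite big_distrr /=.
apply: leq_trans (_ : \sum_(a in T) #|[set v in X | (f v == a) && core (p v)]| <= _).
  apply: leq_sum => a aT; apply: leq_trans (c3' a); rewrite leq_mul2l; apply/orP; right.
  apply: subset_leq_card; apply/subsetP => v; rewrite !inE.
  by move=> /andP[/andP[/andP[-> ->] _] ->].
apply: leq_trans (_ : \sum_(a in T) #|[set v in X :&: fball e (s + D) u | f v == a]| <= _).
  apply: leq_sum => a /imsetP[w wY aE]; apply: subset_leq_card; apply/subsetP => v.
  rewrite !inE => /and3P[-> /eqP va _]; rewrite va eqxx !andbT /=.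
  move: wY; rewrite !inE => /andP[_ uw]; apply: dist_leb_trans uw _.
  have h : dist_leb q (2 * L * m + 2 * L * m) (p w) (p v).
    apply: (@dist_leb_trans _ _ _ _ _ a); first by rewrite dist_leb_sym // aE.
    by rewrite -va; apply: c1.
  apply: dist_leb_leq (dist_leb_quotient diam h); nia.
rewrite sum_fibres_card; apply: subset_leq_card; apply/subsetP => v.
by rewrite inE => /andP[].
Qed.

(** Each coordinate is carved for the set left uncovered by the earlier ones. A round divides the
    local count by [E] and adds [D] to the radius. *)
Lemma padded_coarsenings (V : finType) (e : rel V) (p : nat -> V -> V)
    (D D' L m E c d : nat) :
  symmetric e -> 1 < D ->
  (forall v, #|fball e D v| <= D ^ c) ->
  (forall k u v, p k u = p k v -> dist_leb e D' u v) ->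
  2 * (2 * L * m + L) * D'.+1 + D' <= D ->
  D ^ c * E ^ m < E.+1 ^ m ->
  exists (p' : nat -> V -> V) (g : nat -> V -> nat) (I : nat -> {set V}),
  (forall k,
   [/\ [/\ forall u v, p k u = p k v -> p' k u = p' k v,
       forall u v, p k u = p k v -> g k u = g k v &
       forall u v, p' k u = p' k v -> dist_leb e D u v],
     forall u v, e u v -> g k u <= (g k v).+1,
     forall u v, e u v -> p' k u <> p' k v -> g k u = 0 &
     forall v, v \in I k -> g k v = L]) /\
  forall u s, E ^ d * #|[set v in fball e s u | [forall k : 'I_d, v \notin I k]]|
    <= #|fball e (s + d * D) u|.
Proof.
move=> e_sym D1 growth diam DD' Em; elim: d => [|d [p' [g [I [H1 H2]]]]].
  exists p, (fun _ _ => 0), (fun=> set0); split=> [k|u s].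
    split=> [|||v]; rewrite ?inE //; split=> // u v /diam; apply: dist_leb_leq; lia.
  rewrite mul1n addn0; apply: subset_leq_card.
  by apply/subsetP => v; rewrite inE => /andP[].
pose X := [set v | [forall k : 'I_d, v \notin I k]].
have [p1 [g1 [I1 [h1 h2 h3 h4 h5]]]] :=
  @padded_coarsening V e (p d) X D D' L m E c e_sym D1 growth (diam d) DD' Em.
pose sub T (a : T) (f : nat -> T) k := if k == d then a else f k.
exists (sub _ p1 p'), (sub _ g1 g), (sub _ I1 I); rewrite /sub; split.
  by move=> k; case: eqVneq => [->|_]; [|exact: H1].
move=> u s; rewrite expnSr -mulnA mulSn addnA.
apply: leq_trans (H2 u (s + D)); rewrite leq_mul2l; apply/orP; right.
apply: leq_trans (_ : E * #|(X :\: I1) :&: fball e s u| <= _).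
  rewrite leq_mul2l; apply/orP; right; apply: subset_leq_card; apply/subsetP => v.
  rewrite in_set => /andP[vb /forallP h]; rewrite in_setI vb andbT in_setD in_set.
  have := h ord_max; rewrite eqxx => -> /=; apply/forallP => k.
  by have := h (widen_ord (leqnSn d) k); rewrite /= ltn_eqF.
apply: leq_trans (h5 u s) _; apply: subset_leq_card; apply/subsetP => v.
by rewrite in_setI !in_set andbC.
Qed.

(** * Words separating distant vertices *)

(* [None] opens a block, [Some None] closes a complete code word, and
   [Some (Some b)] is the bit [b]. *)
Notation letter := (option (option bool)).

Definition code (t : seq bool) : seq letter :=
  None :: rcons (map (Some \o Some) t) (Some None).

Definition block (q : seq letter) : bool :=
  if q is a :: q' then (a == None) && (None \notin q') else true.

(** The word is read from the right: [st.1] is the unfinished block, [st.2] the finished ones. *)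
Definition parse_step (a : letter) (st : seq letter * seq (seq letter)) :=
  if a is None then ([::], (None :: st.1) :: st.2) else (a :: st.1, st.2).

Definition parse (w : seq letter) : seq letter * seq (seq letter) :=
  foldr parse_step ([::], [::]) w.

Lemma parse_flatten (bs : seq (seq letter)) : all block bs ->
  parse (flatten bs) = ([::], [seq q <- bs | q != [::]]).
Proof.
elim: bs => //= q bs IH /andP[bq /IH {}IH].
rewrite /parse foldr_cat -/(parse (flatten bs)) IH.
case: q bq => //= a q /andP[/eqP -> nq]; rewrite /parse_step.
suff -> : forall r, foldr parse_step ([::], r) q = (q, r) by [].
by move=> r; elim: q nq => //= -[a'|] q IHq; rewrite inE // => /IHq ->.
Qed.

Lemma mem_block_flatten (bs bs' : seq (seq letter)) (q : seq letter) :
  all block bs -> all block bs' -> flatten bs = flatten bs' ->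
  q != [::] -> (q \in bs) = (q \in bs').
Proof.
move=> b b' /(congr1 parse); rewrite !parse_flatten // => -[h] q0.
by have := congr1 (fun r => q \in r) h; rewrite !mem_filter q0.
Qed.

Lemma size_code t : size (code t) = (size t).+2.
Proof. by rewrite /= size_rcons size_map. Qed.

Lemma code_inj : injective code.
Proof.
by move=> t t' [] /rcons_inj[]; apply: inj_map => a b [].
Qed.

Lemma block_take_code g t : block (take g (code t)).
Proof.
case: g => [|g] //=; apply/negP => /mem_take.
by rewrite mem_rcons inE /= => /mapP[].
Qed.

(** The closing letter occurs only at the end of a code word, so no proper prefix passes for a
    complete one. *)
Lemma last_take_code g t : last None (take g (code t)) = Some None ->
  take g (code t) = code t.
Proof.
have H q : Some None \notin (q : seq letter) -> last None q <> Some None.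
  by case: q => // a q /negP nq e; apply: nq; rewrite -e /=; apply: mem_last.
have nS : Some None \notin map (Some \o Some) t by apply/negP => /mapP[].
case: g => [|g] //=; rewrite -cats1 take_cat size_map; case: ltnP => h.
  move=> e; case: (H (take g (map (Some \o Some) t))); rewrite ?e //.
  by apply: contra nS => /mem_take.
case: (g - _) => [|k]; last by rewrite /code cats1.
by rewrite take0 cats0 => /(H _ nS).
Qed.

(* In coordinate [k], [p k] is the partition reached so far and [fw k v] lists the
   blocks of the word of [v], coarsest level first. *)
Definition separating (V : finType) (e : rel V) (d D1 D D'' b : nat)
    (p : nat -> V -> V) (fw : nat -> V -> seq (seq letter)) : Prop :=
  [/\ forall k u v, p k u = p k v -> dist_leb e D u v,
      forall k u v, e u v -> p k u <> p k v -> flatten (fw k u) = [::],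
      forall k u v, e u v -> tree_adj (flatten (fw k u)) (flatten (fw k v)),
      forall k v (q : seq letter), q \in fw k v -> block q /\ size q < b &
      forall x y, ~~ dist_leb e D1 x y -> dist_leb e D'' x y ->
        exists2 k, k < d & exists q : seq letter,
          [/\ q \in fw k x, last None q = Some None & q \notin fw k y]].

(** The new block goes in front. A pair at distance at most [D] keeps its old separating block,
    which is too short to be a new complete code word. For a pair beyond [D], some coordinate shows
    the complete code word of the class of [x], and [y] lies in another class with another code
    word. *)
Lemma separating_step (V : finType) (e : rel V) (D1 D' D D'' n m E c d b : nat) p fw :
  symmetric e -> 1 < D -> b <= n.+2 ->
  (forall v, #|fball e D v| <= D ^ c) ->
  (forall v, #|fball e (D + D'') v| < 2 ^ n) ->
  (forall v, #|fball e (d * D) v| < E ^ d) ->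
  2 * (2 * n.+2 * m + n.+2) * D'.+1 + D' <= D ->
  D ^ c * E ^ m < E.+1 ^ m ->
  separating e d D1 D' D b p fw ->
  exists p1 fw1, separating e d D1 D D'' n.+3 p1 fw1.
Proof.
move=> e_sym D_gt1 bn growth growth2 growth3 DD' Em [diam bd adj sz sep].
have [p1 [g [I [H1 H2]]]] :=
  @padded_coarsenings V e p D D' n.+2 m E c d e_sym D_gt1 growth diam DD' Em.
(* An uncovered [x] would force [E ^ d] vertices into its ball of radius [d * D]. The depth [n.+2]
   is the length of a code word for [n] bits. *)
have cover x : exists2 k, k < d & g k x = n.+2.
  have := H2 x 0; rewrite add0n => /leq_ltn_trans /(_ (growth3 x)).
  case: (boolP [forall k : 'I_d, x \notin I k]) => [h|]; last first.
    rewrite negb_forall => /existsP[k]; rewrite negbK => xI _.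
    by exists k => //; have [_ _ _] := H1 k; apply.
  rewrite ltnNge leq_pmulr // card_gt0; apply/set0Pn; exists x.
  by rewrite in_set h andbT in_set dist_leb_refl.
(* Classes within [D''] of a given class meet the ball of radius [D + D''] about any of its
   vertices, so greedy colouring needs only [n] bits. *)
have /choice[id idP] : forall k, exists id : V -> n.-tuple bool, forall x y,
    dist_leb e D'' x y -> p1 k x <> p1 k y -> id (p1 k x) <> id (p1 k y).
  move=> k; pose r a b := [exists x, exists y, [&& p1 k x == a, p1 k y == b & dist_leb e D'' x y]].
  have r_sym : symmetric r.
    suff H a a' : r a a' -> r a' a by move=> a a'; apply/idP/idP; apply: H.
    move=> /existsP[x /existsP[y /and3P[h1 h2 h3]]].
    by apply/existsP; exists y; apply/existsP; exists x; rewrite h1 h2 dist_leb_sym.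
  have [|col colP] := @greedy_colouring V (n.-tuple bool) r r_sym.
    move=> a; rewrite card_tuple card_bool.
    case: (pickP [pred x | p1 k x == a]) => [x /= /eqP xa|none]; last first.
      rewrite (_ : [set _ | _ & _] = set0) ?cards0 ?expn_gt0 //; apply/setP => a'.
      rewrite !inE; apply/negP => /andP[/existsP[x /existsP[y /and3P[h _ _]]] _].
      by have := none x; rewrite /= h.
    apply: leq_ltn_trans (growth2 x); apply: leq_trans (leq_imset_card (p1 k) _).
    apply: subset_leq_card; apply/subsetP => a'; rewrite inE => /andP[].
    move=> /existsP[x' /existsP[y /and3P[/eqP h1 /eqP h2 h3]]] _.
    apply/imsetP; exists y => //; rewrite inE; apply: dist_leb_trans h3.
    by have [[_ _ dm] _ _ _] := H1 k; apply: dm; rewrite xa.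
  exists col => x y xy pxy; apply: colP; last exact/eqP.
  by apply/existsP; exists x; apply/existsP; exists y; rewrite !eqxx.
pose blk k v := take (g k v) (code (id k (p1 k v))).
exists p1, (fun k v => blk k v :: fw k v); split.
- by move=> k; have [[_ _ dm] _ _ _] := H1 k.
- move=> k u v uv puv /=; have [[h1 _ _] _ h3 _] := H1 k.
  rewrite /blk (h3 u v) // take0 /=; apply: (bd k u v) => //.
  by move=> /h1.
(* Inside a class of [p k] the new block is constant. Across a boundary the old words are empty, and
   the new depth changes by at most one or vanishes on both sides. *)
- move=> k u v uv /=; have [[h1 h2 _] h3 h4 _] := H1 k.
  have [puv|puv] := pselect (p k u = p k v).
    by rewrite /blk (h1 _ _ puv) (h2 _ _ puv); apply: tree_adj_cat; apply: adj.
  have vu : e v u by rewrite e_sym.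
  have pvu : p k v <> p k u by move=> /esym.
  rewrite (bd k u v) // (bd k v u) // !cats0 /blk.
  have [p1uv|p1uv] := pselect (p1 k u = p1 k v).
    by rewrite p1uv; apply: tree_adj_take; apply: h3.
  rewrite (h4 u v) // (h4 v u) ?take0 //; first by left.
  by move=> /esym.
- move=> k v q; rewrite inE => /orP[/eqP ->|/sz[h1 h2]].
    split; first exact: block_take_code.
    by rewrite /blk size_take_min size_code size_tuple; lia.
  by split=> //; lia.
move=> x y nD1 xy.
have [xyD|xyD] := boolP (dist_leb e D x y).
  have [k kd [q [qx ql qy]]] := sep x y nD1 xyD; exists k => //; exists q.
  rewrite inE qx orbT; split=> //; rewrite inE negb_or qy andbT.
  apply/eqP => qE; rewrite qE in ql; have := last_take_code ql.
  rewrite -/(blk k y) -qE => /(congr1 size); rewrite size_code size_tuple.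
  by move=> qs; have [_] := sz _ _ _ qx; rewrite qs; lia.
have [k kd gk] := cover x; exists k => //.
have bE : blk k x = code (id k (p1 k x)).
  by rewrite /blk gk take_oversize // size_code size_tuple.
exists (blk k x); split; first by rewrite inE eqxx.
  by rewrite bE /= last_rcons.
rewrite inE negb_or; apply/andP; split.
  apply/eqP => h; have := last_take_code (g := g k y) (t := id k (p1 k y)).
  rewrite -/(blk k y) -h bE /= last_rcons => /(_ erefl) [] /rcons_inj[hh].
  have pne : p1 k x <> p1 k y.
    move=> pe; have [[_ _ dm] _ _ _] := H1 k; have := dm _ _ pe; exact/negP.
  apply: (idP k x y xy pne); apply/val_inj/code_inj.
  by rewrite /code /= hh.
apply/negP => /sz[_]; rewrite bE size_code size_tuple; lia.
Qed.

(** * Finite graphs *)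

(** Bernoulli's inequality for [1 + 1/E], with denominators cleared. *)
Lemma double_expn_leq_succ (E : nat) : 0 < E -> 2 * E ^ E <= E.+1 ^ E.
Proof.
move=> E0; have H j : (E + j) * E ^ j <= E * E.+1 ^ j.
  elim: j => [|j IH]; first by rewrite addn0 !expn0.
  rewrite !expnS; apply: leq_trans (_ : E.+1 * ((E + j) * E ^ j) <= _).
    by rewrite mulnA [leqRHS]mulnA leq_mul2r; apply/orP; right; nia.
  by rewrite [leqRHS]mulnCA leq_mul2l IH orbT.
by have := H E; rewrite addnn -muln2 -mulnA leq_pmul2l.
Qed.

Lemma expn_succ_dominates (E k : nat) : 0 < E ->
  2 ^ k * E ^ (E * k.+1) < E.+1 ^ (E * k.+1).
Proof.
move=> E0; rewrite !expnM.
apply: leq_trans (_ : (2 * E ^ E) ^ k.+1 <= _); last first.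
  by rewrite leq_exp2r // double_expn_leq_succ.
by rewrite expnMn ltn_pmul2r ?expn_gt0 ?E0 // ltn_exp2l.
Qed.

(** With [x = 2 ^ (40 * s)] the left side is of order [(s * c) ^ 2 * x ^ 3], and [x] exceeds
    [(s * c) ^ 2] by a factor of at least [2 ^ 20], which absorbs the constants; the right side is
    [x ^ 4]. *)
Lemma level_width_ineq (s c : nat) (n := 400 * s * c)
    (m := 2 ^ (40 * s) * (160 * s * c).+1) : 0 < s -> 0 < c -> c <= 2 ^ s ->
  2 * (2 * n.+2 * m + n.+2) * (2 ^ (80 * s)).+1 + 2 ^ (80 * s) <= 2 ^ (160 * s).
Proof.
move=> s0 c0 cs; set x := 2 ^ (40 * s) in m *.
have sy : s <= 2 ^ s by rewrite ltnW // ltn_expl.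
have -> : 2 ^ (80 * s) = x * x by rewrite /x -expnD; congr (_ ^ _); lia.
have -> : 2 ^ (160 * s) = (x * x) * (x * x) by rewrite /x -!expnD; congr (_ ^ _); lia.
have x0 : 0 < x by rewrite expn_gt0.
have sc0 : 0 < s * c by rewrite muln_gt0 s0.
have scx : 2 ^ 20 * ((s * c) * (s * c)) <= x.
  apply: leq_trans (_ : 2 ^ 20 * ((2 ^ s * 2 ^ s) * (2 ^ s * 2 ^ s)) <= _).
    by rewrite leq_mul2l; apply/orP; right; apply: leq_mul; apply: leq_mul.
  by rewrite -!expnD leq_exp2l //; lia.
move: (s * c) (mulnA 400 s c) (mulnA 160 s c) sc0 scx => z h1 h2 z0 zx.
rewrite /m /n -{}h1 -{}h2 {m n}.
have L402 : (400 * z).+2 <= 402 * z by lia.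
have m161 : x * (160 * z).+1 <= x * (161 * z) by rewrite leq_mul2l; lia.
apply: leq_trans (_ : 2 * (2 * (402 * z) * (x * (161 * z)) + 402 * z) * (x * x).+1 + x * x <= _).
  by rewrite leq_add2r leq_mul // leq_mul // leq_add // leq_mul // leq_mul2l L402 orbT.
apply: leq_trans (_ : (2 ^ 20 * (z * z)) * (x * x * x) <= _); last first.
  by rewrite [leqRHS](_ : _ = x * (x * x * x)) ?leq_mul // !mulnA.
have zz : z <= z * z by nia.
have -> : 2 ^ 20 = 1024 * 1024 by rewrite (expnD 2 10 10).
have [w wE] : exists w, w = z * z by exists (z * z).
have -> : 2 * (402 * z) * (x * (161 * z)) = 402 * 322 * (x * w).
  by rewrite wE; lia.
rewrite -wE in zz *.
have xw : 402 * z <= 402 * (x * w) by nia.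
apply: leq_trans (_ : 2 * (402 * 323 * (x * w)) * (2 * (x * x)) + x * x <= _).
  by rewrite leq_add2r leq_mul //; [lia|nia].
have : x * x <= w * (x * x * x) by nia.
lia.
Qed.

Section FiniteGraph.
Variables (V : finType) (e : rel V) (c : nat).
Hypotheses (e_sym : symmetric e) (c_gt0 : 0 < c).
Hypothesis growth : forall r v, 1 < r -> #|fball e r v| <= r ^ c.

(** [2 ^ lg] lies between [c] and [2 * c], so [D 1] is polynomial in [c]; [s] doubles at each level,
    so [D] squares. *)
Let lg := (trunc_log 2 c).+1.
Let s i := lg * 2 ^ i.
Let D i := 2 ^ (80 * s i).
Let n i := 400 * s i * c.
Let d := 8 * c.

Lemma separating_levels i : exists p fw,
  separating e d (D 1) (D i) (D i.+1) (n i).+2 p fw.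
Proof.
have D_gt1 j : 1 < D j.
  by rewrite /D -[X in X < _](expn0 2) ltn_exp2l // !muln_gt0 expn_gt0.
elim: i => [|i [p [fw H]]].
  (* At level 0 the separation clause is vacuous, since both its bounds are [D 1]. *)
  exists (fun _ v => v), (fun _ _ => [::]); split=> //.
  - by move=> k u v ->; apply: dist_leb_refl.
  - by move=> k u v _; left.
  - by move=> x y /negP.
have s0 : 0 < s i by rewrite muln_gt0 expn_gt0.
have cs : c <= 2 ^ s i.
  have /andP[_ /ltnW h] := @trunc_log_bounds 2 c isT c_gt0.
  by apply: leq_trans h _; rewrite leq_exp2l // leq_pmulr // expn_gt0.
have sS : s i.+1 = 2 * s i by rewrite /s expnS; lia.
have D1E : D i.+1 = 2 ^ (160 * s i) by rewrite /D sS; congr (_ ^ _); lia.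
have D2E : D i.+2 = 2 ^ (320 * s i).
  by rewrite /D /s !expnS; congr (_ ^ _); rewrite /s; lia.
(* [E] is the fourth root of [D i.+1], and [m] is large enough for [(1 + 1/E) ^ m] to exceed
   [D i.+1 ^ c]. *)
pose E := 2 ^ (40 * s i).
pose m := E * (160 * s i * c).+1.
have [|||||||p1 [fw1 [h1 h2 h3 h4 h5]]] := @separating_step V e (D 1) (D i) (D i.+1) (D i.+2)
    (n i) m E c d (n i).+2 p fw e_sym (D_gt1 _); rewrite ?leqnn //.
- by move=> v; apply: growth.
- move=> v; apply: leq_ltn_trans (growth _ _) _; first by have := D_gt1 i.+1; lia.
  apply: leq_ltn_trans (_ : (2 ^ (321 * s i)) ^ c < _).
    rewrite leq_exp2r // (_ : 321 * s i = s i + 320 * s i); last lia.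
    rewrite expnD D1E D2E; apply: leq_trans (_ : 2 * 2 ^ (320 * s i) <= _).
      by rewrite mul2n -addnn leq_add2r leq_exp2l //; lia.
    by rewrite leq_mul2r -[X in X <= _](expn1 2) leq_exp2l // s0 orbT.
  by rewrite -expnM ltn_exp2l // /n ltn_pmul2r // ltn_pmul2r.
- move=> v; apply: leq_ltn_trans (growth _ _) _; first by have := D_gt1 i.+1; rewrite /d; nia.
  (* [8 * c * D i.+1] is at most [2 ^ (164 * s i)], while [E ^ d] is the [c]-th power of
     [2 ^ (320 * s i)]. *)
  apply: leq_ltn_trans (_ : (2 ^ (164 * s i)) ^ c < _).
    rewrite leq_exp2r // (_ : 164 * s i = 3 * s i + s i + 160 * s i); last lia.
    rewrite expnD (expnD 2 (3 * s i)) -D1E leq_mul2r; apply/orP; right; rewrite /d leq_mul //.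
    by rewrite -[8]/(2 ^ 3) leq_exp2l //; lia.
  by rewrite /E /d -!expnM ltn_exp2l // mulnA ltn_pmul2r // mulnAC ltn_pmul2r.
- by rewrite D1E /D; apply: level_width_ineq.
- by rewrite D1E -expnM; apply: expn_succ_dominates; rewrite expn_gt0.
exists p1, fw1; split=> // k v q /h4[? h]; split=> //; apply: leq_trans h _.
by rewrite /n sS; nia.
Qed.

(** The tree colours make all words agree at times [i] and [t + i], so the two vertices have the
    same blocks and are at distance at most [D 1]; there [base] separates distinct vertices. *)
Lemma finite_walk_nonrepetitive : exists (K : finType) (phi : V -> K),
  #|K| <= maxn 2 c ^ (416 * c) /\
  forall (t : nat) (x : nat -> V),
    (forall i, i.+1 < t + t -> e (x i) (x i.+1)) ->
    (forall i, i < t -> phi (x i) = phi (x (t + i))) ->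
    forall i, i < t -> x i = x (t + i).
Proof.
(* [f] bounds every finite distance, so level [R] reaches all connected pairs. *)
have /choice[f fP] : forall xy : V * V, exists r, forall s,
    dist_leb e s xy.1 xy.2 -> dist_leb e r xy.1 xy.2.
  move=> xy; have [[r h]|no] := pselect (exists r, dist_leb e r xy.1 xy.2); first by exists r.
  by exists 0 => r h; case: no; exists r.
pose R := \max_xy f xy.
have [p [fw [_ _ adj blk sep]]] := separating_levels R.
have far x y r : dist_leb e r x y -> dist_leb e (D R.+1) x y.
  move=> /(fP (x, y)) /=; apply: dist_leb_leq; apply: leq_trans (leq_bigmax (x, y)) _.
  rewrite -/R; have h := ltn_expl R (isT : 1 < 2).
  by apply: leq_trans (ltnW h) _; rewrite leq_exp2l // /s /lg expnS; nia.
have D1_gt1 : 1 < D 1.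
  by rewrite /D -[X in X < _](expn0 2) ltn_exp2l // !muln_gt0.
have [||base baseP] := @greedy_colouring V 'I_(D 1 ^ c) (dist_leb e (D 1)).
- by move=> x y; apply: dist_leb_sym.
- move=> v; rewrite card_ord; apply: leq_trans (growth v D1_gt1).
  apply: proper_card; apply/properP; split.
    by apply/subsetP => u; rewrite !inE => /andP[].
  by exists v; rewrite !inE ?dist_leb_refl // eqxx andbF.
pose word k v := flatten (fw k v).
exists ('I_(D 1 ^ c) * {ffun 'I_d -> option letter * ('I_3 * (bool * bool))})%type.
exists (fun v => (base v, [ffun k : 'I_d => tree_colour (word k v)])); split.
  rewrite card_prod card_ffun !card_ord card_prod !card_option.
  rewrite card_prod card_ord card_prod !card_bool.
  rewrite /D /s -!expnM expn1.
  (* A tree colour takes [5 * 3 * 4 = 60] values, at most [2 ^ 6]. The exponents add up to at most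
     [208 * lg * c], and [2 ^ lg] is at most the square of [maxn 2 c]. *)
  apply: leq_trans (_ : 2 ^ (80 * (lg * 2) * c) * 2 ^ (6 * d) <= _).
    by rewrite leq_mul2l; apply/orP; right; rewrite (expnM 2 6) leq_exp2r // muln_gt0.
  rewrite -expnD; apply: leq_trans (_ : (2 ^ lg) ^ (208 * c) <= _).
    by rewrite -expnM leq_exp2l // /d /lg; nia.
  rewrite (_ : 416 * c = 2 * (208 * c)); last lia.
  rewrite [in leqRHS]expnM leq_exp2r ?muln_gt0 // /lg expnS.
  have /andP[h _] := @trunc_log_bounds 2 c isT c_gt0.
  by rewrite -mulnn leq_mul // ?leq_maxl // (leq_trans h) // leq_maxr.
move=> t x wlk rep i it.
have reach j k : j + k < t + t -> dist_leb e k (x j) (x (j + k)).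
  elim: k => [|k IH] h; first by rewrite addn0 dist_leb_refl.
  by rewrite addnS; apply: dist_leb_step (IH _) (wlk _ _); lia.
have xy : dist_leb e (D R.+1) (x i) (x (t + i)).
  by apply: (far _ _ t); rewrite addnC; apply: reach; lia.
have words k : k < d -> word k (x i) = word k (x (t + i)).
  move=> kd; apply: (@tree_nonrepetitive _ t (fun i => word k (x i))) => // j jt.
    by apply: adj; apply: wlk.
  have := rep j jt => /(congr1 snd) /= /ffunP /(_ (Ordinal kd)); rewrite !ffunE /=.
  exact.
have [near|nnear] := boolP (dist_leb e (D 1) (x i) (x (t + i))).
  apply/eqP; apply: contraT => ne; case: (baseP _ _ near ne).
  by have /(congr1 fst) := rep i it.
have [k kd [q [qx ql qy]]] := sep _ _ nnear xy.
have bl v : all block (fw k v) by apply/allP => q' /blk[].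
move: qy; rewrite -(mem_block_flatten (bl (x i)) (bl _) (words _ kd)) ?qx //.
by case: q ql {qx}.
Qed.
End FiniteGraph.

(** * Compactness *)

(* Imported here because [classical_sets] shadows the names of [finset]. *)
From mathcomp Require Import classical_sets functions cardinality filter.

(** The colouring is the limit of the [phi S] along an ultrafilter containing every cone of lists
    above a given one. On a finite support it agrees with some [phi S] whose [S] contains that
    support. *)
Lemma colouring_compactness (T : eqType) (K : finType) (J : Type)
    (supp : J -> seq T) (R : J -> (T -> K) -> Prop) :
  (forall j (phi psi : T -> K), {in supp j, phi =1 psi} -> R j phi -> R j psi) ->
  (forall S : seq T, exists phi, forall j, {subset supp j <= S} -> R j phi) ->
  exists phi, forall j, R j phi.
Proof.
move=> loc /choice[phi phiP].
pose up (S : seq T) : set (seq T) := [set S' | {subset S <= S'}]%classic.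
have upF : ProperFilter (filter_from setT up).
  apply: filter_from_proper; last by move=> S _; exists S => x.
  apply: filter_from_filter; first by exists [::].
  move=> S S' _ _; exists (S ++ S') => // S'' sub; split=> x xS; apply: sub;
    by rewrite mem_cat xS ?orbT.
have [U [Uu upU]] := ultraFilterLemma upF.
(* If no colour were taken by almost all [phi S] at [v], excluding the finitely many colours one by
   one would leave none. *)
have /choice[psi psiP] : forall v, exists k, U [set S | phi S v = k]%classic.
  move=> v; apply: contrapT => /forallNP no.
  have H (ks : seq K) : U [set S | phi S v \notin ks]%classic.
    elim: ks => [|k ks IH]; first by apply: filterS filterT => S _.
    have [/no //|nk] := in_ultra_setVsetC [set S | phi S v = k]%classic Uu.
    apply: filterS2 nk IH => S /= /eqP h1 h2.
    by rewrite inE negb_or h1.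
  have [S /=] := filter_ex (H (enum K)).
  by rewrite mem_enum.
exists psi => j.
have H (s : seq T) : U [set S | {in s, phi S =1 psi}]%classic.
  elim: s => [|v s IH]; first by apply: filterS filterT => S _.
  apply: filterS2 (psiP v) IH => S /= h1 h2 x; rewrite inE => /orP[/eqP ->|/h2] //.
have U1 : U (up (supp j)) by apply: upU; exists (supp j).
have [S [h1 h2]] := filter_ex (filterI (H (supp j)) U1).
exact: loc h1 (phiP S j h2).
Qed.

Lemma dist_le_seq (G : sgraph) (n r : nat) (x : nat -> G) : n <= r ->
  (forall i, i < n -> adj (x i) (x i.+1)) -> dist_le r (x 0) (x n).
Proof.
move=> nr h; exists n, (fun i : 'I_n.+1 => x i); split=> // i j ij.
by rewrite ij; apply: h; rewrite -ltnS -ij.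
Qed.

Lemma dist_leb_dist_le (G : sgraph) (V : finType) (f : V -> G) (r : nat) (v u : V) :
  dist_leb (fun a b => `[< adj (f a) (f b) >]) r v u -> dist_le r (f v) (f u).
Proof.
suff H : dist_leb (fun a b => `[< adj (f a) (f b) >]) r v u ->
    exists n (x : nat -> G), [/\ n <= r, forall i, i < n -> adj (x i) (x i.+1),
      x 0 = f v & x n = f u].
  by move=> /H[n [x [nr h <- <-]]]; apply: dist_le_seq.
elim: r u => [|r IH] u.
  by rewrite dist_leb0 => /eqP ->; exists 0, (fun=> f u).
rewrite dist_lebS => /existsP[w /andP[/IH[n [x [nr h x0 xn]]]]].
move=> /orP[/eqP <-|/asboolP wu]; first by exists n, x; split=> //; apply: leqW.
exists n.+1, (fun i => if i <= n then x i else f u); split=> //; last by rewrite ltnn.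
move=> i; rewrite ltnS => i_n; rewrite i_n; case: ltnP => [/h //|ni].
by rewrite (_ : i = n) ?xn //; apply/eqP; rewrite eqn_leq i_n.
Qed.

Lemma card_le_finset (T : Type) (V : finType) (f : V -> T) (A : set T) (B : {set V}) N :
  injective f -> (A #<= `I_N)%card -> (forall v, v \in B -> A (f v)) -> #|B| <= N.
Proof.
move=> f_inj /pcard_leP[g] BA.
case: N g => [|N] g.
  rewrite leqn0 cards_eq0; apply/eqP/setP => v; rewrite inE; apply/negP => /BA.
  by move=> /(@funS _ _ _ _ g).
rewrite -[leqRHS]card_ord -(@card_in_imset _ _ (fun v => inord (g (f v)) : 'I_N.+1)).
  exact: max_card.
move=> v w vB wB /(congr1 (@nat_of_ord _)).
rewrite !inordK; [|exact: (@funS _ _ _ _ g _ (BA _ _))..].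
by move=> h; apply: f_inj; apply: (@inj _ _ _ g) h; rewrite inE; apply: BA.
Qed.

(** For [c = 0] a 2-ball has at most one vertex; this case lies outside the finite construction. *)
Lemma polynomial_growth_no_edge (G : sgraph) (x y : G) :
  polynomial_growth G 0 -> ~ adj x y.
Proof.
move=> pg xy; have xNy : x <> y by move=> e; move: xy; rewrite e; apply: adj_irrefl.
have := @card_le_finset G bool (fun b => if b then x else y) (ball 2 x) [set: bool]%SET 1.
rewrite cardsT card_bool => /(_ _ (pg 2 isT x)) h.
suff : 2 <= 1 by [].
apply: h => [[] [] // /esym //|[] _].
  exact: (@dist_le_seq G 0 2 (fun=> x)).
apply: (@dist_le_seq G 1 2 (fun i => if i is 0 then x else y)) => //.
by case.
Qed.

Lemma walk_nonrepetitive_colouring (G : sgraph) (c : nat) :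
  polynomial_growth G c ->
  exists phi : G -> 'I_(maxn 2 c ^ (416 * c)), walk_nonrepetitive phi.
Proof.
move=> pg; set M := maxn 2 c ^ (416 * c).
have M0 : 0 < M by rewrite expn_gt0 leq_max.
(* Walks become sequences on [nat] of which only the first [t + t] entries matter; [{classic G}]
   supplies decidable equality. *)
suff [phi phiP] : exists phi : {classic G} -> 'I_M, forall j : nat * (nat -> {classic G}),
    (forall i, i.+1 < j.1 + j.1 -> adj (j.2 i : G) (j.2 i.+1)) ->
    (forall i, i < j.1 -> phi (j.2 i) = phi (j.2 (j.1 + i))) ->
    forall i, i < j.1 -> j.2 i = j.2 (j.1 + i).
  exists phi => t w t0 ww rep; split=> // i.
  have tt0 : 0 < t + t by rewrite addn_gt0 t0.
  pose x k := w (insubd (Ordinal tt0) k).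
  have xE (k : 'I_(t + t)) : x k = w k by rewrite /x valKd.
  have xl (k : 'I_t) : x k = w (lshift t k) by rewrite -xE.
  have xr (k : 'I_t) : x (t + k) = w (rshift t k) by rewrite -xE.
  rewrite -xl -xr; apply: (phiP (t, x)) => //= k kt.
    rewrite -[k]/(nat_of_ord (Ordinal (ltnW kt))) -[X in adj _ (x X)]/(nat_of_ord (Ordinal kt)).
    by rewrite !xE; apply: ww.
  by rewrite -[k]/(nat_of_ord (Ordinal kt)) xl xr.
case: (posnP c) => [c0|c_gt0].
  exists (fun=> Ordinal M0) => -[t x] /= wlk _ i it; exfalso.
  rewrite c0 in pg; apply: (polynomial_growth_no_edge pg (wlk 0 _)); lia.
pose supp (j : nat * (nat -> {classic G})) := map j.2 (iota 0 (j.1 + j.1)).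
apply: (@colouring_compactness {classic G} 'I_M _ supp).
  move=> [t x] phi psi eqp h wlk rep; apply: h => //= i it.
  have mem k : k < t + t -> x k \in supp (t, x) by move=> kt; rewrite map_f // mem_iota.
  rewrite /= !eqp; [exact: rep|apply: mem; lia..].
(* The subgraph induced on [S] inherits the growth bound, since its balls lie in balls of [G]. *)
move=> S; pose V := seq_sub S.
pose e : rel V := fun a b => `[< adj (val a : G) (val b) >].
have [|||K [phi [KM phiP]]] := @finite_walk_nonrepetitive V e c.
- by move=> a b; apply/asboolP/asboolP; apply: adj_sym.
- by [].
- move=> r v r1; apply: (@card_le_finset G V val (ball r (val v))); first exact: val_inj.
    exact: pg.
  by move=> u; rewrite inE => /dist_leb_dist_le.
pose psi (v : {classic G}) := if insub v is Some a
  then widen_ord KM (enum_rank (phi (a : V))) else Ordinal M0.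
exists psi => -[t x] sub /= wlk rep.
have xS k : k < t + t -> x k \in S.
  by move=> kt; apply: sub; rewrite map_f // mem_iota.
move=> i it; have i0 : 0 < t + t by lia.
pose y k : V := insubd (SeqSub (xS 0 i0)) (x k).
have yE k : k < t + t -> val (y k) = x k by move=> kt; exact: insubdK (xS _ kt).
have psiE (a : V) : psi (val a) = widen_ord KM (enum_rank (phi a)) by rewrite /psi valK.
have lt1 k : k < t -> k < t + t by lia.
have lt2 k : k < t -> t + k < t + t by lia.
rewrite -(yE _ (lt1 _ it)) -(yE _ (lt2 _ it)); congr val; apply: phiP it => k kt.
  by apply/asboolP; rewrite !yE //; [apply: wlk|lia].
apply: enum_rank_inj; apply: val_inj; have := rep k kt.
rewrite -(yE _ (lt1 _ kt)) -(yE _ (lt2 _ kt)) !psiE.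
by move=> /(congr1 (@nat_of_ord _)).
Qed.

Lemma walk_to_stroll_nonrepetitive (G : sgraph) (K : Type) (phi : G -> K) :
  walk_nonrepetitive phi -> stroll_nonrepetitive phi.
Proof.
move=> wn [//|t] w t0 [ww ne] rep; have [_ eqw] := wn _ _ t0 ww rep.
exact: ne ord0 (eqw ord0).
Qed.

Lemma is_minimum_exists (P : nat -> Prop) (n : nat) : P n ->
  exists2 k, is_minimum P k & k <= n.
Proof.
move=> Pn; have exP : exists k, `[< P k >] by exists n; apply/asboolP.
case: (ex_minnP exP) => k /asboolP Pk kmin; exists k; last exact/kmin/asboolP.
by split=> // j Pj; apply/kmin/asboolP.
Qed.

(* The base is [maxn 2 c] rather than [c] only because of c = 1: K_2 satisfies
   the growth condition with c = 1 but needs 2 > 1 ^ (C * 1) colours.  For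
   every other c the bound equals c ^ (C * c) (both are 1 when c = 0). *)
Theorem theorem19 :
  exists C : nat, forall (G : sgraph) (c : nat),
    polynomial_growth G c ->
    exists rho sigma : nat,
      [/\ is_rho G rho, is_sigma G sigma,
          rho <= sigma & sigma <= maxn 2 c ^ (C * c)].
Proof.
exists 416 => G c pg.
have [sigma sigmaP sigma_le] : exists2 sigma, is_sigma G sigma &
    sigma <= maxn 2 c ^ (416 * c).
  by apply: is_minimum_exists; apply: walk_nonrepetitive_colouring.
have [phi /walk_to_stroll_nonrepetitive phiP] := sigmaP.1.
have [rho rhoP rho_le] : exists2 rho, is_rho G rho & rho <= sigma.
  by apply: is_minimum_exists; exists phi.
by exists rho, sigma.
Qed.
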